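(* Let $W:\mathbb K\to\mathbb R$ be a continuous function which is a fixed point of $\mathcal R$ on $\mathbb K$, i.e. $W(x)=W(\sigma(H(x)))+W(H(x))$ for all $x\in\mathbb K$, and such that $\sum_{k=1}^{\infty}\mathrm{Var}_k(W)<\infty$. Then $W=U_c$ on $\mathbb K$ with $c=W(\rho_0)$.
   Context: $\Sigma=\{0,1\}^{\mathbb N}$ is the one-sided full shift (sequences $x=x_0x_1x_2\dots$) with shift $\sigma$. $H$ is the Thue-Morse substitution $0\mapsto 01$, $1\mapsto 10$, acting on words and on sequences in $\Sigma$ by concatenation; $\rho_0,\rho_1\in\Sigma$ are its two fixed points, beginning with $0$ and $1$ respectively. $\mathbb K=\overline{\{\sigma^n(\rho_0):n\ge0\}}=\overline{\{\sigma^n(\rho_1):n\ge0\}}$ is the Thue-Morse subshift (one has $H(\mathbb K)\subset\mathbb K$). The renormalization operator is $(\mathcal R V)(x)=V(\sigma(H(x)))+V(H(x))$. The variation on $k$-cylinders is $\mathrm{Var}_k(W)=\max\{|W(x)-W(y)| : x_j=y_j \text{ for } j=0,\dots,k-1\}$ (over $x,y$ in the domain of $W$). For $c\in\mathbb R$, $U_c$ is the function equal to $c$ on the cylinder $[01]$, to $-c$ on $[10]$, and to $0$ on $[00]\cup[11]$. *)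

(* Defs.v *)
(* The letters 0 and 1 are false and true. *)
From mathcomp Require Import all_boot all_order all_algebra.
From mathcomp Require Import all_classical all_reals all_analysis.
Import Order.TTheory GRing.Theory Num.Theory.
Import numFieldNormedType.Exports.

Set Implicit Arguments.
Unset Strict Implicit.
Unset Printing Implicit Defensive.

Local Open Scope classical_set_scope.
Local Open Scope ring_scope.

Definition shift (x : cantor_space) : cantor_space := fun n => x n.+1.

Definition tm_letter (a : bool) : seq bool :=
  if a then [:: true; false] else [:: false; true].

Definition tm_word (w : seq bool) : seq bool := flatten (map tm_letter w).

(* Since both images have length 2, the n-th letter of the infinite
   concatenation H(x_0) H(x_1) ... is letter (n mod 2) of H(x_(n/2)). *)
Definition tm_seq (x : cantor_space) : cantor_space :=
  fun n => nth false (tm_letter (x n./2)) (odd n).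

(* The word H^n(a) is a prefix of H^(n+1)(a) and has length 2^n > n, so its
   n-th letter is the n-th letter of the limit sequence; [tm_fixP] checks that
   this limit is the unique fixed point of H beginning with a. *)
Definition rho (a : bool) : cantor_space :=
  fun n => nth false (iter n tm_word [:: a]) n.

Definition thue_morse : set cantor_space :=
  closure (range (fun n : nat => iter n shift (rho false))).

Definition renorm (R : realType) (V : cantor_space -> R) : cantor_space -> R :=
  fun x => V (shift (tm_seq x)) + V (tm_seq x).

(* Variation on k-cylinders of the restriction of W to A. As an extended-real
   supremum it is meaningful for every W; it is a finite maximum when W is
   continuous on a nonempty compact set A. *)
Definition Var (R : realType) (A : set cantor_space) (W : cantor_space -> R)
    (k : nat) : \bar R :=
  ereal_sup [set e | exists x y : cantor_space,
    [/\ A x, A y, (forall j, (j < k)%N -> x j = y j)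
      & e = (`|W x - W y|)%:E]].

Definition U (R : realType) (c : R) (x : cantor_space) : R :=
  match x 0%N, x 1%N with
  | false, true => c
  | true, false => - c
  | _, _ => 0
  end.

Lemma size_tm_word w : size (tm_word w) = (size w).*2.
Proof. by elim: w => [//|[] w IH] /=; rewrite IH. Qed.

Lemma nth_tm_word w n : (n < (size w).*2)%N ->
  nth false (tm_word w) n = nth false (tm_letter (nth false w n./2)) (odd n).
Proof.
elim: w n => [//|a w IH] [|[|n]] /=; [by case: a|by case: a|].
move=> h; rewrite negbK -IH; last by rewrite doubleS !ltnS in h.
by case: a.
Qed.

Lemma size_iter_tm_word n a : size (iter n tm_word [:: a]) = (2 ^ n)%N.
Proof.
by elim: n => [//|n IH]; rewrite iterS size_tm_word IH expnS mul2n.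
Qed.

Lemma nth_iter_tm_word n m a i : (n <= m)%N -> (i < 2 ^ n)%N ->
  nth false (iter m tm_word [:: a]) i = nth false (iter n tm_word [:: a]) i.
Proof.
elim: n m i => [|n IH] m i lenm.
  rewrite expn0 ltnS leqn0 => /eqP -> /=; elim: m {lenm} => [//|m IHm].
  rewrite iterS nth_tm_word ?IHm /=; first by case: a {IHm}.
  by rewrite size_iter_tm_word double_gt0 expn_gt0.
case: m lenm => [//|m]; rewrite ltnS => lenm lei; rewrite !iterS.
have h : (i < (2 ^ n).*2)%N by rewrite -mul2n -expnS.
rewrite !nth_tm_word ?size_iter_tm_word //; last first.
  by apply: leq_trans h _; rewrite leq_double leq_exp2l.
by rewrite IH // -ltn_double (leq_ltn_trans _ h) // -{2}[i]odd_double_half leq_addl.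
Qed.

Lemma tm_fixP a (x : cantor_space) : tm_seq x = x /\ x 0%N = a <-> x = rho a.
Proof.
have fix_rho : tm_seq (rho a) = rho a.
  apply/funext => n; rewrite /tm_seq /rho.
  have lt2 k : (k < 2 ^ k)%N by exact: ltn_expl.
  have hn : (n./2 <= n)%N by rewrite leq_half_double -addnn -addnS leq_addr.
  rewrite -(nth_iter_tm_word a hn (lt2 _)).
  rewrite -(nth_iter_tm_word a (leqnSn n) (lt2 n)) iterS nth_tm_word //.
  by rewrite size_iter_tm_word (leq_trans (lt2 n)) // -addnn leq_addr.
split => [[fx x0]|->]; last by split.
apply/funext => n; elim/ltn_ind: n => -[|n] IH; first by rewrite x0.
by rewrite -fx -fix_rho /tm_seq IH // ltnS leq_uphalf_double -addnn leq_addr.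
Qed.

(* Main.v *)
(* Iterating the fixed-point equation writes W x as the Birkhoff sum of W of
   length 2^n along the orbit of H^n x. If x and y share their first two letters,
   then H^n x and H^n y share 2^(n+1) letters, so |W x - W y| is at most the sum
   of Var_k over 2^n < k <= 2^(n+1), which tends to 0: W depends on x_0 x_1 only.
   Since H 0 = 01 and H 1 = 10, the fixed-point equation becomes
   w_00 = w_10 + w_01, w_01 = w_11 + w_01, w_11 = w_01 + w_10, which forces
   w_11 = 0, w_10 = - w_01 and w_00 = 0. *)
Require Import Defs.
From HB Require Import structures.
From mathcomp Require Import all_boot all_order all_algebra.
From mathcomp Require Import all_classical all_reals all_analysis.
From mathcomp Require Import zify.
Import Order.TTheory GRing.Theory Num.Theory.
Import numFieldNormedType.Exports.

Set Implicit Arguments.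
Unset Strict Implicit.
Unset Printing Implicit Defensive.

Local Open Scope classical_set_scope.
Local Open Scope ring_scope.

(* MathComp-Analysis exports another [shift], which would shadow this one. *)
Local Notation shift := Defs.shift.

(** Each output letter reads one input letter, and fixing that letter is an open condition because
    [bool] is discrete. Both [shift] and [tm_seq] have this form. *)
Lemma continuous_coordwise (f : cantor_space -> cantor_space)
    (s : nat -> nat) (g : nat -> bool -> bool) :
  (forall x n, f x n = g n (x (s n))) -> continuous f.
Proof.
move=> fE x; apply/cvg_sup => i U [V [[B oB BV] Vfx] VU].
apply: (filterS VU); rewrite -BV /=.
have xs : nbhs x [set y : cantor_space | y (s i) = x (s i)].
  exact: (@proj_continuous nat (fun=> bool) (s i) x _
           (discrete_set1 (x (s i)))).
apply: filterS xs => y /= yx; rewrite fE yx -fE.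
by move: Vfx; rewrite -BV.
Qed.

Lemma continuous_closure_stable {T : topologicalType} (f : T -> T) (A : set T) :
  continuous f -> (forall x, A x -> A (f x)) ->
  forall x, closure A x -> closure A (f x).
Proof.
move=> cf fA x clx B /cf /clx [y [Ay By]].
by exists (f y); split; [exact: fA|].
Qed.

Lemma tm_seq_shift x : tm_seq (shift x) = shift (shift (tm_seq x)).
Proof. by apply/funext => n; rewrite /tm_seq /shift /= negbK. Qed.

Lemma tm_seq_iter_shift n x :
  tm_seq (iter n shift x) = iter n.*2 shift (tm_seq x).
Proof. by elim: n => //= n <-; rewrite tm_seq_shift. Qed.

Lemma iter_shiftE n x i : iter n shift x i = x (n + i)%N.
Proof. by elim: n i => //= n IH i; rewrite /shift IH addnS. Qed.

Lemma tm_seq_rho a : tm_seq (rho a) = rho a.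
Proof. by have [_ /(_ erefl)[]] := tm_fixP a (rho a). Qed.

Lemma thue_morse_rho : thue_morse (rho false).
Proof. by apply: subset_closure; exists 0%N. Qed.

Lemma thue_morse_shift x : thue_morse x -> thue_morse (shift x).
Proof.
apply: continuous_closure_stable.
  exact: (@continuous_coordwise _ S (fun=> id)).
by move=> _ [n _ <-]; exists n.+1.
Qed.

(** By $H\sigma^n=\sigma^{2n}H$ and $H\rho_0=\rho_0$, the map $H$ preserves the orbit of $\rho_0$,
    hence its closure. *)
Lemma thue_morse_tm_seq x : thue_morse x -> thue_morse (tm_seq x).
Proof.
apply: continuous_closure_stable.
  exact: (@continuous_coordwise _ half
    (fun n b => nth false (tm_letter b) (odd n))).
by move=> _ [n _ <-]; exists n.*2 => //; rewrite tm_seq_iter_shift tm_seq_rho.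
Qed.

Lemma thue_morse_iter_shift n x : thue_morse x -> thue_morse (iter n shift x).
Proof. by move=> Kx; elim: n => //= n; exact: thue_morse_shift. Qed.

Lemma thue_morse_iter_tm_seq n x : thue_morse x -> thue_morse (iter n tm_seq x).
Proof. by move=> Kx; elim: n => //= n; exact: thue_morse_tm_seq. Qed.

Lemma iter_tm_seq_prefix k n (x y : cantor_space) :
  (forall j, (j < k)%N -> x j = y j) ->
  forall j, (j < 2 ^ n * k)%N -> iter n tm_seq x j = iter n tm_seq y j.
Proof.
move=> xy; elim: n => [|n IH] j; first by rewrite mul1n; exact: xy.
rewrite expnS -mulnA mul2n => jlt; rewrite !iterS /tm_seq IH //.
by rewrite -ltn_double (leq_ltn_trans _ jlt) // -{2}[j]odd_double_half leq_addl.
Qed.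

Section fixed_point.
Variables (R : realType) (W : cantor_space -> R).

Lemma Var_ge0 k : (0 <= Var thue_morse W k)%E.
Proof.
(* A diagonal pair contributes 0; over an empty domain the supremum would be $-\infty$. *)
apply: ereal_sup_ubound; exists (rho false), (rho false).
by split; rewrite ?subrr ?normr0 //; exact: thue_morse_rho.
Qed.

Hypothesis W_fix : forall x, thue_morse x -> W x = renorm W x.

(** The equation at $\sigma^j x$ splits term $j$ into terms $2j$ and $2j+1$ along the orbit of $Hx$,
    since $H\sigma^j=\sigma^{2j}H$. *)
Lemma birkhoff_sum_tm_seq m x : thue_morse x ->
  \sum_(j < m) W (iter j shift x) = \sum_(j < m.*2) W (iter j shift (tm_seq x)).
Proof.
move=> Kx; elim: m => [|m IH]; first by rewrite !big_ord0.
rewrite doubleS !big_ord_recr /= IH -addrA; congr (_ + _).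
rewrite W_fix; last exact: thue_morse_iter_shift.
by rewrite /renorm tm_seq_iter_shift addrC.
Qed.

Lemma birkhoff_sum_iter_tm_seq n x : thue_morse x ->
  W x = \sum_(j < 2 ^ n) W (iter j shift (iter n tm_seq x)).
Proof.
move=> Kx; elim: n => [|n IH]; first by rewrite big_ord_recl big_ord0 addr0.
rewrite expnS mul2n iterS -birkhoff_sum_tm_seq //.
exact: thue_morse_iter_tm_seq.
Qed.

Lemma dist_le_Var_tail n x y : thue_morse x -> thue_morse y ->
  (forall j, (j < 2)%N -> x j = y j) ->
  (`|W x - W y|%:E <= \sum_(2 ^ n <= i <oo) Var thue_morse W i.+1)%E.
Proof.
move=> Kx Ky xy.
apply: le_trans (@nneseries_lim_ge _ _ xpredT _ (2 ^ n + 2 ^ n)%N _); last first.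
  by move=> *; exact: Var_ge0.
rewrite (birkhoff_sum_iter_tm_seq n Kx) (birkhoff_sum_iter_tm_seq n Ky) -sumrB.
apply: (@le_trans _ _
  (\sum_(j < 2 ^ n) `|W (iter j shift (iter n tm_seq x))
                      - W (iter j shift (iter n tm_seq y))|)%:E).
  by rewrite lee_fin ler_norm_sum.
rewrite -sumEFin -[X in (_ <= \sum_(X <= _ < _) _)%E]add0n.
rewrite big_addn addnK big_mkord.
(* The $j$-th shifts agree on $2^{n+1}-j$ letters, so the variations are summed in reverse order to
   pair term $j$ with index $2^{n+1}-j$. *)
rewrite [leRHS](reindex_inj rev_ord_inj) /=; apply: lee_sum => j _.
apply: ereal_sup_ubound; exists (iter j shift (iter n tm_seq x)).
exists (iter j shift (iter n tm_seq y)).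
split => //; try exact/thue_morse_iter_shift/thue_morse_iter_tm_seq.
move=> i ilt; rewrite !iter_shiftE; apply: (@iter_tm_seq_prefix 2) => //.
move: (nat_of_ord j) (ltn_ord j) ilt => m /=; lia.
Qed.

Hypothesis W_var : (\sum_(1 <= k <oo) Var thue_morse W k < +oo)%E.

Lemma fixed_point_locally_constant x y : thue_morse x -> thue_morse y ->
  x 0%N = y 0%N -> x 1%N = y 1%N -> W x = W y.
Proof.
move=> Kx Ky xy0 xy1; apply/eqP; rewrite -subr_eq0 -normr_le0 leNgt.
apply/negP => d_gt0.
have tail0 : (\sum_(N <= i <oo) Var thue_morse W i.+1)%E @[N --> \oo] --> 0%E.
  apply: (@nneseries_tail_cvg _ (fun i => Var thue_morse W i.+1) xpredT).
    move: W_var; rewrite -(nneseries_addn 1); last by move=> *; exact: Var_ge0.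
    by under eq_eseriesr do rewrite addn1.
  by move=> *; exact: Var_ge0.
have [N _ tailN] : \forall N \near \oo,
    (\sum_(N <= i <oo) Var thue_morse W i.+1 < `|W x - W y|%:E)%E.
  apply: (tail0 [set z | (z < `|W x - W y|%:E)%E]).
  by apply: open_nbhs_nbhs; split; [exact: open_ereal_lt_ereal|rewrite /= lte_fin].
(* Since $N<2^N$, the tail from $2^N$ is already below the distance that it should bound. *)
have := tailN (2 ^ N)%N (ltnW (ltn_expl N (ltnSn 1))).
by apply/negP; rewrite -leNgt; apply: dist_le_Var_tail => // -[|[]].
Qed.

End fixed_point.

Theorem theorem1 (R : realType) (W : cantor_space -> R)
    (W_cont : {within thue_morse, continuous W})
    (W_fix : forall x, thue_morse x -> W x = renorm W x)
    (W_var : (\sum_(1 <= k <oo) Var thue_morse W k < +oo)%E) :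
  forall x, thue_morse x -> W x = U (W (rho false)) x.
Proof.
have W_eq := @fixed_point_locally_constant R W W_fix W_var.
set r := rho false; have Kr : thue_morse r := thue_morse_rho.
have Hr : tm_seq r = r := tm_seq_rho false.
have Kr1 : thue_morse (shift r) := thue_morse_shift Kr.
have Kr2 : thue_morse (shift (shift r)) := thue_morse_shift Kr1.
(* [r = 0110...] begins with 01, [shift r] with 11, [shift (shift r)] with 10 *)
have W11 : W (shift r) = 0.
  (* As $Hr=r$, the equation at $r$ reads $W(r)=W(\sigma r)+W(r)$. *)
  by have := W_fix r Kr; rewrite /renorm Hr -{1}[W r]add0r => /addIr.
have W10 : W (shift (shift r)) = - W r.
  have := W_fix _ Kr1; rewrite /renorm W11.
  (* $H(\sigma r)$ begins with 1010, so it and its shift lie in $[10]$ and $[01]$. *)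
  rewrite (W_eq (tm_seq (shift r)) (shift (shift r))) //; last first.
    exact: thue_morse_tm_seq.
  rewrite (W_eq (shift (tm_seq (shift r))) r) //; last first.
    exact/thue_morse_shift/thue_morse_tm_seq.
  by move/esym/eqP; rewrite addrC addr_eq0 => /eqP.
move=> x Kx; rewrite /U; case x0 : (x 0%N); case x1 : (x 1%N).
- by rewrite (W_eq x (shift r)).
- by rewrite (W_eq x (shift (shift r))).
- by rewrite (W_eq x r).
(* For $x\in[00]$, $Hx$ begins with 0101, so $W(x)=w_{10}+w_{01}=0$. *)
- rewrite W_fix // /renorm (W_eq (tm_seq x) r) //; last 3 first.
  + exact: thue_morse_tm_seq.
  + by rewrite /tm_seq /= x0.
  + by rewrite /tm_seq /= x0.
  rewrite (W_eq (shift (tm_seq x)) (shift (shift r))) //; last 3 first.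
  + exact/thue_morse_shift/thue_morse_tm_seq.
  + by rewrite /shift /tm_seq /= x0.
  + by rewrite /shift /tm_seq /= x1.
  by rewrite W10 addNr.
Qed.
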